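(* Let $\mathcal{B}$ be a demand network with root $o$, $H$ a physical network with injective terminal map $\iota$, physical edges independently open with probability $p$, and $\Phi$ a gauge. Let $D=(T,F)$ be a random usable demand subnetwork with selected open repair routes $\{\gamma_e\}_{e\in F}$ and corresponding random costs $W_e\ge0$. Suppose that, conditional on $D$, there is a unit flow $\theta$ on $D$ from $o$ to infinity such that $$\sum_{e\in F}\mathbb{E}[W_e\mid D]\,\Phi(|\theta(e)|)<\infty.$$ Then $$\sum_{e\in F}W_e\,\Phi(|\theta(e)|)<\infty\quad\text{almost surely},$$ and the corresponding physical component (the component of $\iota(o)$ in the open physical network) supports a finite $\Phi$-energy lifted flow. In particular, if deterministic numbers $C_e$ satisfy $$\mathbb{E}[W_e\mid D]\le C_e,\qquad\sum_{e\in F}C_e\,\Phi(|\theta(e)|)<\infty,$$ then $\sum_{e\in F}W_e\,\Phi(|\theta(e)|)<\infty$ almost surely.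
   Context: Graphs are locally finite and undirected; flows are antisymmetric functions on oriented edges. Since flows to infinity are considered, the graphs are infinite. A demand network is a connected locally finite multigraph $\mathcal{B}$ (parallel edges allowed) with a distinguished root $o$. A physical network is a locally finite graph $H=(V_H,E_H)$ together with an injective map $\iota$ from the vertices of $\mathcal{B}$ to $V_H$. A unit flow from $o$ to infinity is an antisymmetric function $\theta$ on oriented edges with $\operatorname{div}\theta(o)=1$ and $\operatorname{div}\theta(x)=0$ for $x\ne o$, where $\operatorname{div}\theta(x)$ is the sum of $\theta$ over all oriented edges leaving $x$ (parallel edges counted separately). A gauge is an increasing convex function $\Phi:[0,\infty)\to[0,\infty)$ with $\Phi(0)=0$ (increasing is understood strictly). The $\Phi$-energy on a graph $X$ is $\mathcal{E}^\Phi_X(\theta)=\sum_{e\in E_X}\Phi(|\theta(e)|)$ over unoriented edges. For integers $m\ge1$ put $\alpha_\Phi(m)=\sup_{t>0}\Phi(mt)/\Phi(t)$ and $\beta_\Phi(m)=\alpha_\Phi(m)/m$. For each demand edge $e=\{u,v\}$ a family $\Gamma_e$ of candidate routes (finite paths in $H$ joining $\iota(u)$ to $\iota(v)$) is specified; $e$ is repairable if some route of $\Gamma_e$ is entirely open. A usable demand subnetwork is a subgraph $D=(T,F)$ of $\mathcal{B}$ containing $o$ all of whose edges are repairable, with one open route $\gamma_e\in\Gamma_e$ selected for each $e\in F$. With $m_a=\#\{e\in F:a\in\gamma_e\}$ (assumed finite, with $\alpha_\Phi(m_a)<\infty$ whenever $m_a\ge 1$), the cost of the selected route is $W_e=\sum_{a\in\gamma_e}\beta_\Phi(m_a)$;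 it is random, since it depends on the selected routes. The flow $\theta$ is a (measurable) function of $D$. Lifted flow: orient each $e\in F$, orient $\gamma_e$ consistently, let $\eta_e$ be the unit path flow along $\gamma_e$ ($1$ on edges traversed in the direction of $\gamma_e$, $-1$ on reversed edges, $0$ elsewhere). The lift of $\theta$ is $\Theta=\sum_{e\in F}\theta(e)\eta_e$; it is a unit flow from $\iota(o)$ to infinity. *)

(* Defs.v *)
From HB Require Import structures.
From mathcomp Require Import all_boot all_order all_algebra finmap.
From mathcomp Require Import all_classical all_reals all_analysis.
From mathcomp Require Import measurable_realfun.

Set Implicit Arguments.
Unset Strict Implicit.
Unset Printing Implicit Defensive.

Import Order.TTheory GRing.Theory Num.Theory.

Local Open Scope classical_set_scope.
Local Open Scope ring_scope.

(* Undirected multigraphs.  An edge is an element of [edge], so parallel edges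
   are distinct elements; [src] and [tgt] fix an arbitrary reference
   orientation, which makes "orient each edge" a definite choice.  A simple
   graph is the special case without parallel edges and loops. *)
Record multigraph := Multigraph {
  vertex : choiceType;
  edge : choiceType;
  src : edge -> vertex;
  tgt : edge -> vertex }.

(* Oriented edges: [(e, true)] goes from [src e] to [tgt e]. *)
Definition dart (G : multigraph) := (edge G * bool)%type.

Section Graphs.
Variable G : multigraph.

Definition tail (d : dart G) : vertex G := if d.2 then src d.1 else tgt d.1.
Definition head (d : dart G) : vertex G := if d.2 then tgt d.1 else src d.1.
Definition rev_dart (d : dart G) : dart G := (d.1, ~~ d.2).

Fixpoint walk (x : vertex G) (p : seq (dart G)) (y : vertex G) : bool :=
  if p is d :: p' then (tail d == x) && walk (head d) p' y else x == y.

(* A path visits no vertex twice. *)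
Definition is_path (x : vertex G) (p : seq (dart G)) (y : vertex G) : bool :=
  walk x p y && uniq (x :: map head p).

Definition path_edges (p : seq (dart G)) : seq (edge G) := map fst p.

Definition locally_finite :=
  forall x : vertex G, finite_set [set e : edge G | src e = x \/ tgt e = x].

Definition graph_connected := forall x y : vertex G, exists p, walk x p y.

Definition graph_infinite := infinite_set [set: vertex G].

Record subgraph := Subgraph {
  verts : set (vertex G);
  edges : set (edge G);
  subgraphP : forall e, edges e -> verts (src e) /\ verts (tgt e) }.

Definition full_graph : subgraph :=
  @Subgraph setT setT (fun _ _ => conj I I).

Definition spanning_subgraph (S : set (edge G)) : subgraph :=
  @Subgraph setT S (fun _ _ => conj I I).

Definition cluster (S : set (edge G)) (x : vertex G) : set (vertex G) :=
  [set y | exists p, walk x p y /\ forall a, a \in path_edges p -> S a].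

Lemma walk_rcons x p (d : dart G) :
  walk x p (tail d) -> walk x (rcons p d) (head d).
Proof.
elim: p x => [|d' p IHp] x /=; first by move=> /eqP ->; rewrite !eqxx.
by move=> /andP[-> /IHp].
Qed.

Lemma cluster_step S x (d : dart G) :
  S d.1 -> cluster S x (tail d) -> cluster S x (head d).
Proof.
move=> Sd [p [xp Sp]]; exists (rcons p d); split; first exact: walk_rcons.
move=> a; rewrite /path_edges map_rcons mem_rcons inE => /orP[/eqP -> //|].
exact: Sp.
Qed.

Fact component_subproof (S : set (edge G)) (x : vertex G) (e : edge G) :
  [set a | S a /\ cluster S x (src a)] e ->
  cluster S x (src e) /\ cluster S x (tgt e).
Proof.
by move=> [Se xe]; split=> //; apply: (@cluster_step S x (e, true)).
Qed.

Definition component (S : set (edge G)) (x : vertex G) : subgraph :=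
  Subgraph (@component_subproof S x).

End Graphs.

Section Flows.
Variables (R : realType) (G : multigraph).

(* In a locally finite graph the sum is finite. *)
Definition divergence (theta : dart G -> R) (x : vertex G) : R :=
  \sum_(d \in [set d | tail d = x]) theta d.

(* A flow on a subgraph is extended by zero to the oriented edges of [G]. *)
Definition unit_flow (K : subgraph G) (o : vertex G) (theta : dart G -> R) :=
  [/\ forall d, theta (rev_dart d) = - theta d,
      forall d, ~ edges K d.1 -> theta d = 0,
      divergence theta o = 1
    & forall x, x <> o -> divergence theta x = 0].

Definition flow_energy (Phi : R -> R) (K : subgraph G) (theta : dart G -> R) :
    \bar R :=
  \esum_(e in edges K) (Phi `|theta (e, true)|)%:E.

Definition path_flow (p : seq (dart G)) (d : dart G) : R :=
  if d \in p then 1 else if rev_dart d \in p then -1 else 0.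

End Flows.

Section Gauges.
Variable R : realType.

(* Only the values of [Phi] on [0, +oo[ matter. *)
Definition is_gauge (Phi : R -> R) :=
  [/\ Phi 0 = 0,
      forall x, 0 <= x -> 0 <= Phi x,
      forall x y, 0 <= x -> x < y -> Phi x < Phi y
    & convex_function (`[0, +oo[%classic : set R) Phi].

Definition gauge_alpha (Phi : R -> R) (m : nat) : \bar R :=
  ereal_sup [set (Phi (m%:R * t) / Phi t)%:E | t in [set t : R | 0 < t]].

Definition gauge_beta (Phi : R -> R) (m : nat) : \bar R :=
  (gauge_alpha Phi m * (m%:R^-1)%:E)%E.

End Gauges.

Section Routes.
Variables (R : realType) (B H : multigraph).
Variables (D : subgraph B) (gamma : edge B -> seq (dart H)).

Definition users (a : edge H) : set (edge B) :=
  [set e | edges D e /\ a \in path_edges (gamma e)].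

Definition load (a : edge H) : nat := #|` fset_set (users a)|.

Definition admissible_loads (Phi : R -> R) :=
  forall a, finite_set (users a) /\
    ((1 <= load a)%N -> (gauge_alpha Phi (load a) < +oo)%E).

(* Only edges of [D] have a selected route; the cost of the others is set to
   zero, so that E[W_e | D] is unaffected on the event that e belongs to D. *)
Definition route_cost (Phi : R -> R) (e : edge B) : \bar R :=
  if `[< edges D e >]
  then (\sum_(a <- path_edges (gamma e)) gauge_beta Phi (load a))%E
  else 0%E.

(* Each demand edge is taken in its reference orientation, its route being a
   path from the image of its source to the image of its target. *)
Definition lifted_flow (theta : dart B -> R) (d : dart H) : R :=
  \sum_(e \in edges D) theta (e, true) * path_flow R (gamma e) d.

End Routes.

Definition route_family (B H : multigraph) (iota : vertex B -> vertex H)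
    (Gamma : edge B -> set (seq (dart H))) :=
  forall e r, Gamma e r -> is_path (iota (src e)) r (iota (tgt e)).

Definition open_route (H : multigraph) (S : set (edge H)) (r : seq (dart H)) :=
  forall a, a \in path_edges r -> S a.

Definition repairable (B H : multigraph) (Gamma : edge B -> set (seq (dart H)))
    (S : set (edge H)) (e : edge B) :=
  exists2 r, Gamma e r & open_route S r.

Definition usable (B H : multigraph) (o : vertex B)
    (Gamma : edge B -> set (seq (dart H))) (S : set (edge H))
    (D : subgraph B) (gamma : edge B -> seq (dart H)) :=
  [/\ verts D o,
      forall e, edges D e -> repairable Gamma S e
    & forall e, edges D e -> Gamma e (gamma e) /\ open_route S (gamma e)].

Section Probability.
Context d (Omega : measurableType d) (R : realType).
Variable P : probability Omega R.

Definition bernoulli_percolation (H : multigraph) (p : R)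
    (opened : edge H -> set Omega) :=
  [/\ forall a, measurable (opened a),
      forall a, P (opened a) = p%:E
    & forall J : {fset edge H},
        P (\bigcap_(a in [set` J]) opened a) =
        (\prod_(a <- J) P (opened a))%E].

(* Measurability with respect to the sigma-algebra generated by [C]. *)
Definition measurable_wrt d' (T : sigmaRingType d') (C : set (set Omega))
    (f : Omega -> T) :=
  measurable_fun [set: g_sigma_algebraType C] (f : g_sigma_algebraType C -> T).

(* [Y] is a version of the conditional expectation of the [0, +oo]-valued
   variable [X] given the sigma-algebra generated by [C]. *)
Definition is_cond_expectation (C : set (set Omega)) (X Y : Omega -> \bar R) :=
  [/\ forall w, (0 <= Y w)%E,
      measurable_wrt C Y
    & forall A, <<s C >> A ->
        (\int[P]_(w in A) Y w = \int[P]_(w in A) X w)%E].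

(* Conditioning on [D] means conditioning on the sigma-algebra generated by
   these events; it does not include the selected routes. *)
Definition subgraph_events (B : multigraph) (D : Omega -> subgraph B) :
    set (set Omega) :=
  [set A | (exists x, A = [set w | verts (D w) x]) \/
           (exists e, A = [set w | edges (D w) e])].

Definition random_subgraph (B : multigraph) (D : Omega -> subgraph B) :=
  subgraph_events D `<=` measurable.

Definition random_routes (B H : multigraph) (D : Omega -> subgraph B)
    (gamma : Omega -> edge B -> seq (dart H)) :=
  forall e r, measurable [set w | edges (D w) e /\ gamma w e = r].

End Probability.

(* Main.v *)
Require Import Defs.
From mathcomp Require Import all_boot all_order all_algebra finmap.
From mathcomp Require Import all_classical all_reals all_analysis.
From mathcomp Require Import measurable_realfun.

(** The first conclusion is Tonelli's theorem read through conditional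
    expectations.  Write [phi_e] for [Phi |theta e|] on the event that [e]
    belongs to [D], and 0 elsewhere.  It is measurable with respect to the
    sigma-algebra of [D], so [W_e * phi_e] and [E[W_e | D] * phi_e] have the same
    integral over each event of that sigma-algebra
    ([cond_expectation_mul_on]).  Let [A_k] be the event that the sum of the
    [E[W_e | D] * phi_e] is at most [k].  Summing over [e], the sum of the
    [W_e * phi_e] has integral at most [k] over [A_k], hence is almost surely
    finite there, and the [A_k] exhaust the event that the conditional sum is
    finite ([cond_expectation_series_finite]).  For this the demand edges must
    be countable and [W_e] must be measurable.  Both come from the fact that a
    locally finite graph has countably many walks from a given vertex
    ([countable_walks]): the demand graph is connected, and a demand edge has
    countably many candidate routes even if the physical graph is uncountable.

    The second conclusion holds at each sample where [theta] is a unit flow, the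
    loads are finite and the cost-weighted energy is finite.  A path from [x] to
    [y] carries a unit flow with divergence [1_x - 1_y], so the divergence of the
    lift at [iota v] is that of [theta] at [v], and it vanishes off the image of
    [iota] ([unit_flow_lift]).  On a physical edge [a] used by [m] routes, the
    convexity of [Phi] gives

      [Phi |Theta a| <= (1/m) sum_e Phi (m |theta e|)
                     <= beta(m) sum_e Phi |theta e|],

    the sums being over the users [e] of [a].  Summing over [a] and exchanging
    the sums gives the cost-weighted energy of [theta] ([energy_lift]).  A
    selected open route lies either inside the cluster of [iota o] or outside
    it, so [theta] restricted to the demand edges with routes inside is again a
    unit flow, and its lift is the restriction of [Theta] to the component
    ([lift_component]).

    The third conclusion follows from the first by comparing the two sums term
    by term. *)

Set Implicit Arguments.
Unset Strict Implicit.
Unset Printing Implicit Defensive.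

Import Order.TTheory GRing.Theory Num.Theory.

Local Open Scope classical_set_scope.
Local Open Scope ring_scope.

Local Notation head := Defs.head.
Local Notation cluster := Defs.cluster.

(** * Walks, paths and path flows *)

Section Walks.
Variable G : multigraph.
Implicit Types (x y z : vertex G) (p : seq (dart G)) (c d : dart G).

Lemma rev_dartK : involutive (@rev_dart G).
Proof. by move=> [e b]; rewrite /rev_dart /= negbK. Qed.

Lemma tail_rev d : tail (rev_dart d) = head d.
Proof. by case: d => e []. Qed.

Lemma head_rev d : head (rev_dart d) = tail d.
Proof. by case: d => e []. Qed.

Lemma finite_darts_at x : locally_finite G ->
  finite_set [set d : dart G | tail d = x].
Proof.
move=> /(_ x) fin; apply: (@sub_finite_set _ _
  ([set e : edge G | src e = x \/ tgt e = x] `*` [set: bool])).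
  by move=> [e []] /= <-; split => //; [left|right].
by apply: finite_setX => //; exact: finite_finset.
Qed.

Lemma finite_walks x n : locally_finite G ->
  finite_set [set p | size p = n /\ exists y, walk x p y].
Proof.
move=> lfG; elim: n x => [|n IHn] x.
  apply: (@sub_finite_set _ _ [set [::]]); last exact: finite_set1.
  by move=> p [/size0nil ->].
apply: (@sub_finite_set _ _ (\bigcup_(c in [set c : dart G | tail c = x])
   (cons c @` [set p | size p = n /\ exists y, walk (head c) p y]))).
  move=> [|c p] [] //= [sp] [y] /andP[/eqP cx wp].
  by exists c => //; exists p => //; split=> //; exists y.
apply: bigcup_finite; first exact: finite_darts_at.
by move=> c _; apply: finite_image.
Qed.

(** Holds in an uncountable graph as well, since a walk stays in the component
    of its first vertex. *)
Lemma countable_walks x : locally_finite G ->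
  countable [set p | exists y, walk x p y].
Proof.
move=> lfG; have -> : [set p | exists y, walk x p y] =
    \bigcup_(n in [set: nat]) [set p | size p = n /\ exists y, walk x p y].
  by apply/seteqP; split=> [p xp|p [n _ [_ //]]]; exists (size p).
apply: bigcup_countable => [|n _]; first exact: countableP.
exact/finite_set_countable/finite_walks.
Qed.

(** A walk to the source of an edge extends along that edge, so every edge lies
    on some walk from [x]. *)
Lemma countable_edges x : locally_finite G -> graph_connected G ->
  countable [set: edge G].
Proof.
move=> lfG cG; have -> : [set: edge G] =
    \bigcup_(p in [set p | exists y, walk x p y])
      \bigcup_(c in [set c | c \in p]) [set c.1].
  apply/seteqP; split=> // e _; have [p xp] := cG x (src e).
  exists (rcons p (e, true)); last first.
    by exists (e, true) => //=; rewrite mem_rcons mem_head.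
  by exists (tgt e); exact: (@walk_rcons G x p (e, true)).
apply: bigcup_countable => [|p _]; first exact: countable_walks.
apply: bigcup_countable => [|c _]; last exact: countable1.
exact/finite_set_countable/finite_seq.
Qed.

(** Crossing an edge in both directions would bring the path back to the tail of
    the first crossing. *)
Lemma path_rev_notin x p y d : is_path x p y -> d \in p -> rev_dart d \notin p.
Proof.
rewrite /is_path; elim: p x => // c p IHp x.
rewrite [walk _ _ _]/= map_cons [uniq _]/= inE negb_or.
move=> /andP[/andP[/eqP tc wp] /andP[/andP[_ xp] up]].
have IH : d \in p -> rev_dart d \notin p by apply: (IHp (head c)); rewrite wp.
(* the head of [rev_dart c] is [x], which the path has already visited *)
have rc : rev_dart c \notin p.
  apply: contra xp => rcp; rewrite -tc -head_rev; exact: map_f.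
have neq e : rev_dart e != e by case: e => e [] //=; apply/eqP => -[].
rewrite !inE negb_or => /predU1P[->|dp]; first by rewrite neq rc.
rewrite IH// andbT; apply: contraNneq rc => <-.
by rewrite rev_dartK.
Qed.

Lemma path_uniq x p y : is_path x p y -> uniq p.
Proof. by move=> /andP[_] /= /andP[_]; exact: map_uniq. Qed.

Lemma path_edges_uniq x p y :
  is_path x p y -> uniq (path_edges p).
Proof.
move=> xpy; rewrite map_inj_in_uniq ?(path_uniq xpy)//.
move=> [e b] [e' b'] ep + /= ee'; rewrite -ee' => e'p.
congr (_, _); have := path_rev_notin xpy ep.
by move: ep e'p; rewrite /rev_dart /=; case: b b' => [] [] // ep -> .
Qed.

Lemma cluster_walk S x y p z : cluster S x y -> walk y p z ->
  (forall a, a \in path_edges p -> S a) -> cluster S x z.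
Proof.
elim: p y => [|c p IHp] y xy /=; first by move=> /eqP <-.
move=> /andP[/eqP cy wp] Sp; apply: (IHp (head c)) => //.
  by apply: cluster_step; [apply: Sp; rewrite inE eqxx|rewrite cy].
by move=> a ap; apply: Sp; rewrite inE ap orbT.
Qed.

Lemma cluster_walk_edges S x y p z a : cluster S x y -> walk y p z ->
  (forall a, a \in path_edges p -> S a) -> a \in path_edges p ->
  cluster S x (src a).
Proof.
elim: p y => [|c p IHp] y xy //= /andP[/eqP cy wp] Sp.
have Sc : S c.1 by apply: Sp; rewrite inE eqxx.
have xc : cluster S x (head c) by apply: cluster_step; rewrite // cy.
rewrite inE => /predU1P[->|]; last first.
  by apply: IHp wp _ => // b bp; apply: Sp; rewrite inE bp orbT.
move: cy xc; rewrite /tail /head; case: c.2 => //.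
by move=> ->.
Qed.

(** The converse of the preceding lemma: open walks can be followed backwards, so
    an open route that meets the cluster starts in it. *)
Lemma cluster_walk_edges_start S x y p z a :
  walk y p z -> (forall a, a \in path_edges p -> S a) -> a \in path_edges p ->
  cluster S x (src a) -> cluster S x y.
Proof.
elim: p y => [|c p IHp] y //= /andP[/eqP <- wp] Sp ap xa.
have Sc : S c.1 by apply: Sp; rewrite inE eqxx.
have step : cluster S x (head c) -> cluster S x (tail c).
  by rewrite -(tail_rev c) -(head_rev c); exact: cluster_step.
move: ap; rewrite inE => /predU1P[ac|ap]; last first.
  by apply/step/IHp => // b bp; apply: Sp; rewrite inE bp orbT.
move: xa step; rewrite ac /tail /head; case: c.2 => //.
by move=> xa; apply.
Qed.

Fixpoint rev_walk p := if p is c :: p' then rcons (rev_walk p') (rev_dart c)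
  else [::].

Lemma path_edges_rev p a :
  (a \in path_edges (rev_walk p)) = (a \in path_edges p).
Proof.
elim: p => //= c p IHp.
by rewrite /path_edges map_rcons mem_rcons !inE -/(path_edges _) IHp.
Qed.

Lemma walk_rev x p y : walk x p y -> walk y (rev_walk p) x.
Proof.
elim: p x => [|c p IHp] x /=; first by rewrite eq_sym.
move=> /andP[/eqP <- /IHp yp]; rewrite -[tail c]head_rev; apply: walk_rcons.
by rewrite tail_rev.
Qed.

End Walks.

Section FlowLemmas.
Variables (R : realType) (G : multigraph).
Implicit Types (x y z : vertex G) (p : seq (dart G)) (c d : dart G).

Lemma sum_indicator (T : eqType) (s : seq T) (e : T) : uniq s ->
  \sum_(c <- s) (c == e)%:R = (e \in s)%:R :> R.
Proof.
move=> us; rewrite -natr_sum -(count_uniq_mem _ us) -sum1_count.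
by rewrite [in RHS]big_mkcond; congr (_%:R); apply: eq_bigr => c _; case: eqP.
Qed.

(** The value of a path flow as a sum over the steps of the path, which turns its
    divergence into a telescoping sum. *)
Lemma path_flowE x p y d : is_path x p y ->
  path_flow R p d = \sum_(c <- p) ((c == d)%:R - (rev_dart c == d)%:R).
Proof.
move=> xpy; have up := path_uniq xpy.
rewrite big_split /= sum_indicator// sumrN.
have -> : \sum_(c <- p) (rev_dart c == d)%:R = (rev_dart d \in p)%:R :> R.
  rewrite -sum_indicator//; apply: eq_bigr => c _.
  by rewrite (can2_eq (@rev_dartK G) (@rev_dartK G)).
rewrite /path_flow; case: ifPn => [dp|_].
  by rewrite (negbTE (path_rev_notin xpy dp)) subr0.
by case: (rev_dart d \in p); rewrite mulr0n sub0r ?oppr0.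
Qed.

Lemma path_flow_rev x p y d : is_path x p y ->
  path_flow R p (rev_dart d) = - path_flow R p d.
Proof.
move=> xpy; rewrite !(path_flowE _ xpy) -sumrN; apply: eq_bigr => c _.
rewrite opprB (inj_eq (inv_inj (@rev_dartK G))).
by rewrite [in RHS](can2_eq (@rev_dartK G) (@rev_dartK G)).
Qed.

Lemma divergence_path x p y z : locally_finite G -> is_path x p y ->
  divergence (path_flow R p) z = (x == z)%:R - (y == z)%:R.
Proof.
move=> lfG xpy; have finz := @finite_darts_at G z lfG.
rewrite /divergence fsbig_finite//=.
under eq_bigr do rewrite (path_flowE _ xpy).
rewrite exchange_big/=.
have ind c : \sum_(d <- fset_set [set d | tail d = z]) (c == d)%:R =
    (tail c == z)%:R :> R.
  under eq_bigr do rewrite eq_sym.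
  rewrite sum_indicator ?fset_uniq// in_fset_set//; congr (_%:R).
  by congr nat_of_bool; apply/idP/eqP => [/set_mem|?]; last exact: mem_set.
under eq_bigr do rewrite big_split/= sumrN !ind tail_rev.
(* each step contributes its tail minus its head, and the sum telescopes *)
move: xpy => /andP[+ _]; elim: p x => [|c p IHp] x /=.
  by move=> /eqP ->; rewrite big_nil subrr.
move=> /andP[/eqP <- /IHp]; rewrite big_cons => ->.
by rewrite addrA subrK.
Qed.

End FlowLemmas.

(** * The lift of a unit flow is a unit flow *)

Section Lift.
Variables (R : realType) (B H : multigraph).
Hypotheses (lfB : locally_finite B) (lfH : locally_finite H).
Variable iota : vertex B -> vertex H.
Hypothesis iota_inj : injective iota.
Variables (D : subgraph B) (gamma : edge B -> seq (dart H)).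
Hypothesis gamma_path :
  forall e, edges D e -> is_path (iota (src e)) (gamma e) (iota (tgt e)).
Hypothesis users_fin : forall a, finite_set (users D gamma a).

Lemma path_flow_out (p : seq (dart H)) d :
  d.1 \notin path_edges p -> path_flow R p d = 0.
Proof.
move=> dp; rewrite /path_flow ifF ?ifF//; apply: contraNF dp.
  exact: (@map_f _ _ fst _ (rev_dart d)).
exact: (@map_f _ _ fst _ d).
Qed.

Variable theta : dart B -> R.
Hypothesis theta_off : forall b, ~ edges D b.1 -> theta b = 0.

(** Replaces the sum defining the lift by one over a fixed finite set of demand
    edges, the same for all the oriented edges at a given vertex, so that sums
    can be exchanged. *)
Lemma lifted_flow_sum d (V : set (edge B)) : finite_set V ->
  users D gamma d.1 `<=` V ->
  lifted_flow D gamma theta d =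
    \sum_(e <- fset_set V) theta (e, true) * path_flow R (gamma e) d.
Proof.
move=> finV UV; rewrite -fsbig_finite// /lifted_flow.
rewrite -(@fsbig_widen _ _ _ _ _ _ _ UV); last first.
  move=> e /= [_ nU]; have [De|/(@theta_off (e, true)) ->] := pselect (edges D e).
    rewrite path_flow_out ?mulr0//; apply/negP => dge; exact: nU.
  by rewrite mul0r.
apply/esym/fsbig_widen; first by move=> e [].
move=> e /= [De nU]; rewrite path_flow_out ?mulr0//; apply/negP => dge.
exact: nU.
Qed.

Lemma lifted_flow_out d : users D gamma d.1 `<=` set0 ->
  lifted_flow D gamma theta d = 0.
Proof.
move=> U0; rewrite (lifted_flow_sum _ U0)//.
by rewrite fset_set0 big_seq_fset0.
Qed.

Lemma lifted_flow_rev d :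
  lifted_flow D gamma theta (rev_dart d) = - lifted_flow D gamma theta d.
Proof.
rewrite (lifted_flow_sum (users_fin d.1))// (lifted_flow_sum (users_fin d.1))//.
rewrite -sumrN big_seq [in RHS]big_seq; apply: eq_bigr => e.
rewrite in_fset_set// => /set_mem[De _].
by rewrite (path_flow_rev _ _ (gamma_path De)) mulrN.
Qed.

Lemma divergence_lift x (V : set (edge B)) : finite_set V ->
  (forall d, tail d = x -> users D gamma d.1 `<=` V) ->
  divergence (lifted_flow D gamma theta) x =
    \sum_(e <- fset_set V) theta (e, true) *
      ((iota (src e) == x)%:R - (iota (tgt e) == x)%:R).
Proof.
move=> finV UV; have finx := finite_darts_at x lfH.
rewrite /divergence fsbig_finite// big_seq.
under eq_bigr => d.
  rewrite in_fset_set// => /set_mem dx.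
  rewrite (lifted_flow_sum finV (UV d dx)).
  over.
rewrite -big_seq exchange_big /=; apply: eq_bigr => e _.
have [De|/(@theta_off (e, true)) ->] := pselect (edges D e); last first.
  by rewrite mul0r big1// => d _; rewrite mul0r.
rewrite -mulr_sumr -(divergence_path R x lfH (gamma_path De)).
by rewrite /divergence fsbig_finite.
Qed.

Hypothesis theta_rev : forall b, theta (rev_dart b) = - theta b.

(** The divergence of [theta] in the form that [divergence_lift] produces: each
    edge in its reference orientation, counted with sign at its two ends. *)
Lemma divergence_sum v (V : set (edge B)) : finite_set V ->
  [set e | src e = v \/ tgt e = v] `<=` V ->
  divergence theta v = \sum_(e <- fset_set V) theta (e, true) *
      ((src e == v)%:R - (tgt e == v)%:R).
Proof.
move=> finV sV; rewrite /divergence.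
have -> : [set d : dart B | tail d = v] =
    (V `*` [set` [:: true; false]]) `&` [set d : dart B | tail d = v].
  apply/seteqP; split=> [[e b] /= eb|d [] //]; split=> //; split=> /=.
    by apply: sV; move: eb; case: b => <-; [left|right].
  by clear; case: b; rewrite !inE.
rewrite fsbig_mkcondr.
pose F e b := if (e, b) \in [set d : dart B | tail d = v] then theta (e, b)
  else 0.
transitivity (\sum_(d \in V `*` [set` [:: true; false]]) F d.1 d.2).
  by apply: eq_fsbigr => -[e b] _.
rewrite -pair_fsbig//.
rewrite fsbig_finite//; apply: eq_bigr => e _.
rewrite -fsbig_seq// big_cons big_seq1.
have ind b : F e b = theta (e, b) * (tail (e, b) == v)%:R.
  rewrite /F; case: ifPn => [/set_mem ->|]; first by rewrite eqxx mulr1.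
  by rewrite notin_setE /= => /eqP/negbTE ->; rewrite mulr0.
rewrite !ind mulrBr; congr (_ + _).
by rewrite -mulNr -theta_rev.
Qed.

Lemma unit_flow_lift S o :
  (forall e, edges D e -> open_route S (gamma e)) ->
  divergence theta o = 1 -> (forall x, x <> o -> divergence theta x = 0) ->
  unit_flow (spanning_subgraph S) (iota o) (lifted_flow D gamma theta).
Proof.
move=> gS divo divx.
pose U x := \bigcup_(d in [set d : dart H | tail d = x]) users D gamma d.1.
have finU x : finite_set (U x).
  by apply: bigcup_finite => [|d _]; [exact: finite_darts_at|exact: users_fin].
have div_iota v :
    divergence (lifted_flow D gamma theta) (iota v) = divergence theta v.
  (* finite, and large enough for both [divergence_lift] and
     [divergence_sum] *)
  pose V := U (iota v) `|` [set e | src e = v \/ tgt e = v].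
  have finV : finite_set V by rewrite finite_setU; split=> //; exact: lfB.
  rewrite (@divergence_sum v V)//; last by move=> e ?; right.
  rewrite (@divergence_lift (iota v) V)//; last first.
    by move=> d dv e de; left; exists d.
  by under eq_bigr do rewrite !(inj_eq iota_inj).
split; first exact: lifted_flow_rev.
- move=> d /= nS; apply: lifted_flow_out => e [De de].
  by apply: nS; exact: gS de.
- by rewrite div_iota.
- move=> x xo; have [[v vx]|nx] := pselect (exists v, iota v = x).
    by rewrite -vx div_iota divx// => vo; apply: xo; rewrite -vx vo.
  rewrite (@divergence_lift x (U x))//; last by move=> d dx e de; exists d.
  rewrite big1// => e _; have nxv v : (iota v == x) = false.
    by apply/eqP => vx; apply: nx; exists v.
  by rewrite !nxv subrr mulr0.
Qed.
End Lift.

(** * The energy of the lift *)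

Section GaugeLemmas.
Variables (R : realType) (Phi : R -> R).
Hypothesis gPhi : is_gauge Phi.

Lemma gauge0 : Phi 0 = 0. Proof. by case: gPhi. Qed.

Lemma gauge_ge0 x : 0 <= x -> 0 <= Phi x.
Proof. by case: gPhi => _ + _ _; apply. Qed.

Lemma gauge_gt0 x : 0 < x -> 0 < Phi x.
Proof. by move=> x0; rewrite -gauge0; case: gPhi => _ _ + _; apply. Qed.

Lemma gauge_le x y : 0 <= x -> x <= y -> Phi x <= Phi y.
Proof.
move=> x0; rewrite le_eqVlt => /predU1P[->//|xy].
by apply: ltW; case: gPhi => _ _ + _; apply.
Qed.

(** A gauge is monotone on the nonnegative half-line only; this extension by a
    constant to the negative half-line is monotone everywhere, hence Borel. *)
Lemma gauge_nondecreasing :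
  {homo (fun x => Phi (Num.max 0 x)) : x y / x <= y}.
Proof.
move=> x y xy; apply: gauge_le => //; first by rewrite le_max lexx.
by rewrite ge_max le_max lexx /= le_max xy orbT.
Qed.

Lemma gauge_convex k x y : 0 <= k -> k <= 1 -> 0 <= x -> 0 <= y ->
  Phi (k * x + (1 - k) * y) <= k * Phi x + (1 - k) * Phi y.
Proof.
move=> k0 k1 x0 y0; case: gPhi => _ _ _ /(_ (Itv01 k0 k1) x y).
by apply; rewrite inE /= in_itv /= andbT.
Qed.

(** Jensen's inequality for the uniform weights, written so that it also makes
    sense for the empty sequence.  The induction step averages the new term, with
    weight [1/(n+1)], and the mean of the other [n] terms. *)
Lemma gauge_mean (I : Type) (s : seq I) (t : I -> R) :
  (forall i, 0 <= t i) ->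
  (size s)%:R * Phi ((\sum_(i <- s) t i) / (size s)%:R) <=
  \sum_(i <- s) Phi (t i).
Proof.
move=> t0; elim: s => [|i s IHs]; first by rewrite !big_nil mul0r lexx.
have [s0|s0] := posnP (size s).
  by move: s0 => /size0nil ->; rewrite !big_cons !big_nil /= !mulr1n divr1 mul1r
    !addr0 lexx.
rewrite !big_cons /=; apply: le_trans (lerD (lexx _) IHs).
set n := size s in s0 *; set S := \sum_(j <- s) t j.
have S0 : 0 <= S by apply: sumr_ge0.
have n0 : (n%:R : R) != 0 by rewrite pnatr_eq0 -lt0n.
have n1 : (n.+1%:R : R) != 0 by rewrite pnatr_eq0.
have k1 : (n.+1%:R^-1 : R) <= 1 by rewrite invf_le1 ?ler1n ?ltr0n.
have kE : 1 - n.+1%:R^-1 = n%:R / n.+1%:R :> R.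
  by rewrite -{1}(divff n1) -[X in _ - X]mul1r -mulrBl -{1}natr1 addrK.
(* [(t i + S) / n.+1] is the convex combination of [t i] and the mean [S / n]
   with weights [n.+1^-1] and [n / n.+1] *)
have := @gauge_convex n.+1%:R^-1 (t i) (S / n%:R) _ k1 (t0 i) _.
rewrite invr_ge0 ler0n divr_ge0 ?ler0n// => /(_ isT isT).
have -> : n.+1%:R^-1 * t i + (1 - n.+1%:R^-1) * (S / n%:R) = (t i + S) / n.+1%:R.
  rewrite kE mulrDl [_^-1 * t i]mulrC; congr (_ + _).
  by rewrite mulrC mulrA divfK.
by rewrite kE -(ler_pM2l (_ : 0 < n.+1%:R)) ?ltr0n// mulrDr !mulrA divff// mul1r
  [_ * n%:R]mulrC -[n%:R * _ / _]mulrA divff// mulr1.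
Qed.

(** Jensen's inequality applied to the [n] numbers [n * t i], whose mean is the
    sum of the [t i].  Bounding instead each [t i] by the largest one would lose
    the factor [1/n] that distinguishes [gauge_beta] from [gauge_alpha]. *)
Lemma gauge_sum (I : Type) (s : seq I) (t : I -> R) :
  (forall i, 0 <= t i) ->
  Phi (\sum_(i <- s) t i) <= \sum_(i <- s) Phi ((size s)%:R * t i) / (size s)%:R.
Proof.
move=> t0; have [s0|s0] := posnP (size s).
  by move: s0 => /size0nil ->; rewrite !big_nil gauge0.
have n0 : (0 : R) < (size s)%:R by rewrite ltr0n.
rewrite -mulr_suml ler_pdivlMr// mulrC.
have := @gauge_mean _ s (fun i => (size s)%:R * t i).
rewrite -mulr_sumr mulrAC divff ?gt_eqF// mul1r; apply.
by move=> i; rewrite mulr_ge0.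
Qed.

Lemma gauge_alpha_ge0 m : (0 <= gauge_alpha Phi m)%E.
Proof.
apply: le_trans (ereal_sup_ubound _); last by exists 1 => //=; exact: ltr01.
by rewrite lee_fin divr_ge0// gauge_ge0// mulr_ge0.
Qed.

Lemma gauge_beta_ge0 m : (0 <= gauge_beta Phi m)%E.
Proof. by rewrite mule_ge0 ?gauge_alpha_ge0// lee_fin invr_ge0. Qed.

Lemma gauge_beta_ub m t : 0 <= t ->
  ((Phi (m%:R * t) / m%:R)%:E <= gauge_beta Phi m * (Phi t)%:E)%E.
Proof.
rewrite le_eqVlt => /predU1P[<-|t0].
  by rewrite mulr0 gauge0 mul0r mule0.
rewrite /gauge_beta -muleA -EFinM.
have -> : Phi (m%:R * t) / m%:R = (Phi (m%:R * t) / Phi t) * (m%:R^-1 * Phi t).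
  by rewrite [_^-1 * _]mulrC mulrA divfK// gt_eqF// gauge_gt0.
rewrite [leLHS]EFinM; apply: lee_wpmul2r.
  by rewrite lee_fin mulr_ge0 ?invr_ge0// gauge_ge0// ltW.
by apply: ereal_sup_ubound; exists t.
Qed.
End GaugeLemmas.

Lemma route_cost_ge0 (R : realType) (B H : multigraph) (D : subgraph B)
    (gamma : edge B -> seq (dart H)) (Phi : R -> R) e :
  is_gauge Phi -> (0 <= route_cost D gamma Phi e)%E.
Proof.
move=> gPhi; rewrite /route_cost; case: ifP => // _.
by apply: sume_ge0 => a _; exact: gauge_beta_ge0.
Qed.

Section Energy.
Variables (R : realType) (B H : multigraph).
Variable iota : vertex B -> vertex H.
Variables (D : subgraph B) (gamma : edge B -> seq (dart H)).
Hypothesis gamma_path :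
  forall e, edges D e -> is_path (iota (src e)) (gamma e) (iota (tgt e)).
Hypothesis users_fin : forall a, finite_set (users D gamma a).
Variables (Phi : R -> R) (theta : dart B -> R).
Hypothesis gPhi : is_gauge Phi.
Hypothesis theta_off : forall b, ~ edges D b.1 -> theta b = 0.

(** The flow through [a] is a signed sum over its [load] users, to which Jensen's
    inequality applies. *)
Lemma edge_energy (a : edge H) :
  ((Phi `|lifted_flow D gamma theta (a, true)|)%:E <=
  \esum_(e in users D gamma a)
    gauge_beta Phi (load D gamma a) * (Phi `|theta (e, true)|)%:E)%E.
Proof.
rewrite esum_fset//; last first.
  by move=> e _; rewrite mule_ge0 ?gauge_beta_ge0// lee_fin gauge_ge0.
rewrite fsbig_finite//=.
apply: (@le_trans _ _ (Phi (\sum_(e <- fset_set (users D gamma a))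
    `|theta (e, true)|))%:E).
  rewrite lee_fin gauge_le//.
  rewrite (@lifted_flow_sum _ _ _ _ _ _ theta_off (a, true) _ (users_fin a))//.
  apply: le_trans (ler_norm_sum _ _ _) _; apply: ler_sum => e _.
  rewrite normrM ler_piMr// /path_flow; case: ifP => _; first by rewrite normr1.
  by case: ifP => _; rewrite ?normrN1 ?normr0.
apply: (@le_trans _ _ (\sum_(e <- fset_set (users D gamma a))
   Phi ((load D gamma a)%:R * `|theta (e, true)|) / (load D gamma a)%:R)%:E).
  by rewrite lee_fin gauge_sum.
by rewrite -sumEFin; apply: lee_sum => e _; exact: gauge_beta_ub.
Qed.

(** Sum [edge_energy] over the physical edges and exchange the two sums: the
    coefficients [gauge_beta] met along the route of [e] add up to its cost. *)
Lemma energy_lift :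
  (flow_energy Phi (full_graph H) (lifted_flow D gamma theta) <=
  \esum_(e in edges D) (route_cost D gamma Phi e * (Phi `|theta (e, true)|)%:E))%E.
Proof.
pose f a e := (gauge_beta Phi (load D gamma a) * (Phi `|theta (e, true)|)%:E)%E.
have f0 a e : (0 <= f a e)%E.
  by rewrite mule_ge0 ?gauge_beta_ge0// lee_fin gauge_ge0.
apply: (@le_trans _ _ (\esum_(a in [set: edge H])
  \esum_(e in users D gamma a) f a e)%E).
  by apply: le_esum => a _; exact: edge_energy.
rewrite esum_esum//.
pose Q := fun e : edge B => [set a | a \in path_edges (gamma e)].
rewrite (@reindex_esum _ _ _ (edges D `*`` Q) _ (fun k => (k.2, k.1))); last first.
  split.
  - by move=> [e a] /= [].
  - by move=> [e a] [e' a'] _ _ [-> ->].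
  - by move=> [a e] /= [_ [De ae]]; exists (e, a).
rewrite -(esum_esum (a := fun e a => f a e))//.
apply: le_esum => e De; rewrite esum_fset//; last exact: finite_seq.
rewrite -fsbig_seq; last exact: (path_edges_uniq (gamma_path De)).
rewrite /route_cost asboolT// ge0_sume_distrl// => a _.
exact: gauge_beta_ge0.
Qed.

End Energy.

(** * Restriction to the cluster of the root *)

Section Component.
Variables (R : realType) (B H : multigraph).
Hypotheses (lfB : locally_finite B) (lfH : locally_finite H).
Variable iota : vertex B -> vertex H.
Hypothesis iota_inj : injective iota.
Variables (D : subgraph B) (gamma : edge B -> seq (dart H)).
Hypothesis gamma_path :
  forall e, edges D e -> is_path (iota (src e)) (gamma e) (iota (tgt e)).
Variables (S : set (edge H)) (o : vertex B) (theta : dart B -> R).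
Hypothesis gamma_open : forall e, edges D e -> open_route S (gamma e).
Hypothesis theta_flow : unit_flow D o theta.

Definition flow_in_cluster (b : dart B) : R :=
  if `[< cluster S (iota o) (iota (src b.1)) >] then theta b else 0.

Let theta_off b : ~ edges D b.1 -> theta b = 0.
Proof. by case: theta_flow => _ + _ _; apply. Qed.

(** The open route of [e] joins the two terminals. *)
Lemma cluster_ends e : edges D e ->
  cluster S (iota o) (iota (src e)) <-> cluster S (iota o) (iota (tgt e)).
Proof.
move=> De; have /andP[wg _] := gamma_path De; split=> xs.
  exact: cluster_walk xs wg (gamma_open De).
apply: cluster_walk xs (walk_rev wg) _ => a; rewrite path_edges_rev.
exact: gamma_open.
Qed.

(** By [cluster_ends] the cut-off may be tested at the tail of an oriented edge,
    so the whole star of a vertex is either kept or deleted; this is why the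
    divergence survives. *)
Lemma flow_in_cluster_at d : flow_in_cluster d =
  if `[< cluster S (iota o) (iota (tail d)) >] then theta d else 0.
Proof.
rewrite /flow_in_cluster; have [Dd|/(@theta_off d) ->] := pselect (edges D d.1);
  last by rewrite !if_same.
suff -> : cluster S (iota o) (iota (src d.1)) =
  cluster S (iota o) (iota (tail d)) by [].
by rewrite /tail; case: d.2 => //; apply/propext/cluster_ends.
Qed.

Lemma unit_flow_in_cluster : unit_flow D o flow_in_cluster.
Proof.
case: theta_flow => trev toff divo divx.
have divK v : divergence flow_in_cluster v =
    if `[< cluster S (iota o) (iota v) >] then divergence theta v else 0.
  case: ifPn => /asboolP ov.
    by apply: eq_fsbigr => d /set_mem /= dv; rewrite flow_in_cluster_at dv asboolT.
  by apply: fsbig1 => d /= dv; rewrite flow_in_cluster_at dv asboolF.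
split.
- by move=> d; rewrite /flow_in_cluster /= trev; case: ifP; rewrite ?oppr0.
- by move=> d /toff td; rewrite /flow_in_cluster td if_same.
- by rewrite divK asboolT//; exists [::]; split=> //=.
- by move=> x /divx dx; rewrite divK dx if_same.
Qed.

Let K := component S (iota o).

Lemma lift_in_cluster b : edges K b.1 ->
  lifted_flow D gamma flow_in_cluster b = lifted_flow D gamma theta b.
Proof.
move=> [Sb ob]; apply: eq_fsbigr => e /set_mem De.
have [be|be] := boolP (b.1 \in path_edges (gamma e)); last first.
  by rewrite path_flow_out// !mulr0.
have /andP[wg _] := gamma_path De.
rewrite /flow_in_cluster asboolT//.
exact: cluster_walk_edges_start wg (gamma_open De) be ob.
Qed.

Lemma lift_off_cluster b : ~ edges K b.1 ->
  lifted_flow D gamma flow_in_cluster b = 0.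
Proof.
move=> nK; apply: fsbig1 => e /= De.
have [be|be] := boolP (b.1 \in path_edges (gamma e)); last first.
  by rewrite path_flow_out// mulr0.
have /andP[wg _] := gamma_path De.
rewrite /flow_in_cluster asboolF ?mul0r// => oe; apply: nK; split.
  exact: gamma_open be.
exact: cluster_walk_edges oe wg (gamma_open De) be.
Qed.

Lemma lift_component (Phi : R -> R) : is_gauge Phi ->
  (forall a, finite_set (users D gamma a)) ->
  (\esum_(e in edges D) (route_cost D gamma Phi e * (Phi `|theta (e, true)|)%:E)
    < +oo)%E ->
  let Theta := lifted_flow D gamma theta in
  [/\ unit_flow (spanning_subgraph S) (iota o) Theta,
      (flow_energy Phi (full_graph H) Theta < +oo)%E
    & exists2 thetaK, unit_flow D o thetaK &
        let ThetaK := lifted_flow D gamma thetaK in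
        [/\ forall b, edges K b.1 -> ThetaK b = Theta b,
            unit_flow K (iota o) ThetaK
          & (flow_energy Phi K ThetaK < +oo)%E]].
Proof.
move=> gPhi users_fin cost_fin Theta.
have finE : (flow_energy Phi (full_graph H) Theta < +oo)%E.
  by apply: le_lt_trans cost_fin; exact: (energy_lift gamma_path).
split=> //.
  case: theta_flow => ? ? ? ?; apply: unit_flow_lift => //.
exists flow_in_cluster; first exact: unit_flow_in_cluster.
split.
- by move=> b Kb; exact: lift_in_cluster.
- have [trev toff divo divx] := unit_flow_in_cluster.
  have [? _ ? ?] : unit_flow (spanning_subgraph S) (iota o)
    (lifted_flow D gamma flow_in_cluster) by exact: unit_flow_lift.
  by split=> // b nK; exact: lift_off_cluster.
- apply: le_lt_trans finE; rewrite /flow_energy [leRHS]esum_mkcond esum_mkcond.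
  apply: le_esum => a _ /=; rewrite in_setT; case: ifPn => [/set_mem Ka|_].
    by rewrite lift_in_cluster.
  by rewrite lee_fin gauge_ge0.
Qed.
End Component.

(** * Measurability of the route costs *)

Section Countable.
Context d (T : sigmaRingType d).
(** Unions over a countable subset of an arbitrary, possibly uncountable, type. *)
Lemma countable_bigcup_measurable U (A : set U) (F : U -> set T) :
  countable A -> (forall i, A i -> measurable (F i)) ->
  measurable (\bigcup_(i in A) F i).
Proof.
move=> cA mF; rewrite bigcup_set_type; apply: countable_bigcupT_measurable.
  by rewrite (eq_countable (card_setT _)).
by move=> i; apply: mF; exact: set_valP.
Qed.
End Countable.

Section Cost.
Context d (Omega : measurableType d) (R : realType).
Variables (B H : multigraph) (D : Omega -> subgraph B).
Variable gamma : Omega -> edge B -> seq (dart H).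
Hypothesis HD : random_subgraph D.
Hypothesis Hgamma : random_routes D gamma.
Hypothesis countB : countable [set: edge B].
Variable Q : edge B -> set (seq (dart H)).
Hypothesis countQ : forall e, countable (Q e).
Hypothesis gammaQ : forall w e, edges (D w) e -> Q e (gamma w e).

Lemma measurable_edge e : measurable [set w | edges (D w) e].
Proof. by apply: HD; right; exists e. Qed.

Lemma measurable_user a e : measurable [set w | users (D w) (gamma w) a e].
Proof.
have -> : [set w | users (D w) (gamma w) a e] =
    \bigcup_(r in Q e `&` [set r | a \in path_edges r])
      [set w | edges (D w) e /\ gamma w e = r].
  apply/seteqP; split=> [w [De ae]|w [r [_ ar] [De gr]]].
    by exists (gamma w e); [split=> //; exact: gammaQ|].
  by split=> //; rewrite gr.
apply: countable_bigcup_measurable => [|r _]; last exact: Hgamma.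
by apply: (sub_countable _ (countQ e)); apply: subset_card_le; exact: subIsetl.
Qed.

Lemma measurable_users a J : measurable [set w | users (D w) (gamma w) a = J].
Proof.
have -> : [set w | users (D w) (gamma w) a = J] = ~` \bigcup_e
   [set w | ~ (users (D w) (gamma w) a e <-> J e)].
  apply/seteqP; split=> [w <- [e _] /= []//|w nU].
  apply/seteqP; split=> e; apply: contrapT => neq; apply: nU; exists e => // UJ;
    by apply: neq; case: UJ.
apply: measurableC; apply: countable_bigcup_measurable => // e _.
have [Je|Je] := pselect (J e).
  rewrite (_ : [set w | _] = ~` [set w | users (D w) (gamma w) a e]).
    exact/measurableC/measurable_user.
  by apply/seteqP; split=> w /= nU => [U|[_ JU]]; apply: nU; [split|exact: JU].
rewrite (_ : [set w | _] = [set w | users (D w) (gamma w) a e]).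
  exact/measurable_user.
apply/seteqP; split=> w /= U; last by move=> [UJ _]; exact: Je (UJ U).
by apply: contrapT => nU; apply: U; split.
Qed.

(** There are countably many finite sets of users.  The load is 0 by convention
    when infinitely many routes use [a], hence the separate treatment of the
    event that the set of users is not finite. *)
Lemma measurable_load a (Y : set nat) :
  measurable [set w | Y (load (D w) (gamma w) a)].
Proof.
pose FS := [set J : set (edge B) | finite_set J].
have countFS (Z : set (set (edge B))) : Z `<=` FS -> countable Z.
  move=> ZF; apply: (sub_countable _ (countable_finite_subset countB)).
  by apply: subset_card_le => J /ZF.
pose E Z := \bigcup_(J in Z) [set w | users (D w) (gamma w) a = J].
have mE Z : Z `<=` FS -> measurable (E Z).
  move=> ZF; apply: countable_bigcup_measurable; first exact: countFS.
  by move=> J _; exact: measurable_users.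
rewrite (_ : [set w | _] = E (FS `&` [set J | Y #|` fset_set J|]) `|`
    (if `[< Y 0%N >] then ~` E FS else set0)).
  apply: measurableU; first by apply: mE; exact: subIsetl.
  by case: ifP => _ //; apply/measurableC/mE.
apply/seteqP; split=> w /=.
  have [fU|nU] := pselect (finite_set (users (D w) (gamma w) a)).
    by move=> YU; left; exists (users (D w) (gamma w) a).
  rewrite /load /fset_set; case: pselect => // _; rewrite cardfs0 => Y0; right.
  by rewrite asboolT// => -[J /= fJ UJ]; apply: nU; rewrite UJ.
move=> [[J /= [_ YJ] UJ]|]; first by rewrite /load UJ.
case: asboolP => // Y0 /= nE; rewrite /load /fset_set; case: pselect => [fU|_].
  by exfalso; apply: nE; exists (users (D w) (gamma w) a).
by rewrite cardfs0.
Qed.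

(** On each of the countably many events where the route of [e] is a given [r],
    the cost is a finite sum of functions of loads. *)
Lemma measurable_route_cost (Phi : R -> R) e :
  measurable_fun [set: Omega] (fun w => route_cost (D w) (gamma w) Phi e).
Proof.
move=> _ Y mY; rewrite setTI.
pose c r w := (\sum_(a <- path_edges r) gauge_beta Phi (load (D w) (gamma w) a))%E.
have mc r : measurable_fun [set: Omega] (c r).
  apply: emeasurable_sum => a _ Z mZ; rewrite setTI.
  exact: (measurable_load a (gauge_beta Phi @^-1` Z)).
rewrite (_ : _ @^-1` Y =
  \bigcup_(r in Q e) ([set w | edges (D w) e /\ gamma w e = r] `&` c r @^-1` Y)
  `|` (if `[< Y 0%E >] then ~` [set w | edges (D w) e] else set0)).
  apply: measurableU; last first.
    by case: ifP => _ //; apply/measurableC/measurable_edge.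
  apply: countable_bigcup_measurable => // r _; apply: measurableI.
    exact: Hgamma.
  by rewrite -[X in measurable X]setTI; exact: mc.
apply/seteqP; split=> w /=; rewrite /route_cost.
  case: asboolP => [De Yc|nD Y0]; last by right; rewrite asboolT.
  by left; exists (gamma w e); [exact: gammaQ|].
move=> [[r _ [[De gr]]]|].
  by rewrite asboolT// /c -gr.
by case: asboolP => //= Y0 nD; rewrite asboolF.
Qed.
End Cost.

(** * Conditional expectations *)

Section CondExp.
Context d (Omega : measurableType d) (R : realType).
Variables (P : probability Omega R) (C : set (set Omega)).
Hypothesis CM : C `<=` measurable.

Lemma sigma_sub_measurable : <<s C>> `<=` measurable.
Proof. by apply: smallest_sub => //; exact: sigma_algebra_measurable. Qed.

Lemma measurable_wrt_fun d' (T : sigmaRingType d') (f : Omega -> T) :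
  measurable_wrt C f -> measurable_fun [set: Omega] f.
Proof. move=> mf _ Y mY; apply: sigma_sub_measurable; exact: mf. Qed.

(** Multiplication by [+oo] is not continuous at 0, but a nondecreasing sequence
    of nonnegative reals tends to 0 only if it vanishes identically. *)
Lemma cvg_mull_pinfty (h : nat -> R) (z : \bar R) :
  (forall n, 0 <= h n) -> {homo h : n m / (n <= m)%N >-> n <= m} ->
  (h n)%:E @[n --> \oo] --> z -> (+oo * (h n)%:E)%E @[n --> \oo] --> (+oo * z)%E.
Proof.
move=> h0 nd hz; have [hn|] := pselect (forall n, h n = 0).
  have <- : 0%E = z.
    apply: cvg_unique hz => //.
    by apply: cvg_near_cst; apply: nearW => n; rewrite hn.
  by apply: cvg_near_cst; apply: nearW => n; rewrite hn.
move=> /existsNP[N /eqP hN0]; have hN : 0 < h N by rewrite lt_neqAle eq_sym hN0 h0.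
have z0 : (0 < z)%E.
  apply: (@lt_le_trans _ _ (h N)%:E); first by rewrite lte_fin.
  apply: (cvge_ge _ hz); exists N => // n /= Nn; rewrite lee_fin; exact: nd.
rewrite gt0_mulye//; apply: cvg_near_cst; exists N => // n /= Nn.
by rewrite gt0_mulye// lte_fin (lt_le_trans hN)// nd.
Qed.

Import HBNNSimple.

Section Approx.
Variables (X Z : Omega -> \bar R).
Hypotheses (X0 : forall w, (0 <= X w)%E) (mX : measurable_fun [set: Omega] X).
Variable h : nat -> {nnsfun (g_sigma_algebraType C) >-> R}.
Hypothesis nd_h : forall w, {homo (fun n => h n w) : n m / (n <= m)%N >-> n <= m}.
Hypothesis hZ : forall w, (h n w)%:E @[n --> \oo] --> Z w.

(** The right-hand side depends on [X] only through its integrals over events of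
    the sigma-algebra generated by [C]; two functions with the same such
    integrals therefore have the same integral against [Z]. *)
Lemma integral_mul_approx : (\int[P]_w (X w * Z w))%E = limn (fun n =>
  \sum_(y \in range (h n)) y%:E * \int[P]_(w in h n @^-1` [set y]) X w)%E.
Proof.
have mh n : measurable_fun [set: Omega] (fun w => (h n w)%:E).
  apply/measurable_EFinP.
  by apply: measurable_wrt_fun; exact: measurable_funPT.
have mpre n y : measurable (h n @^-1` [set y] : set Omega).
  by apply: sigma_sub_measurable; exact: (measurable_sfunP (h n)).
have mind n y :
    measurable_fun [set: Omega] (\1_(h n @^-1` [set y]) : Omega -> R).
  by apply: measurable_indic; exact: mpre.
have XZ w : (X w * Z w)%E = limn (fun n => X w * (h n w)%:E)%E.
  apply/esym/cvg_lim => //; case: (X w) (X0 w) => // [r _|_].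
    exact: cvgeZl.
  by apply: cvg_mull_pinfty => // n; exact: nd_h.
under eq_integral do rewrite XZ.
rewrite monotone_convergence//; last 3 first.
- by move=> n; exact: emeasurable_funM.
- by move=> n w _; rewrite mule_ge0// lee_fin.
- by move=> w _ n m nm; rewrite lee_wpmul2l// lee_fin nd_h.
congr (limn _); apply/funext => n.
under eq_integral => w _.
  rewrite fimfunE -fsumEFin// ge0_mule_fsumr; last first.
    by move=> y; rewrite nnfun_muleindic_ge0.
  over.
rewrite ge0_integral_fsum//; last 2 first.
- move=> y; apply: emeasurable_funM => //; apply/measurable_EFinP.
  by apply: measurable_funM => //; exact: mind.
- by move=> y w _; rewrite mule_ge0// nnfun_muleindic_ge0.
apply: eq_fsbigr => y /set_mem[v _ hv].
under eq_integral do rewrite EFinM muleCA.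
rewrite ge0_integralZl//; last 3 first.
- by apply: emeasurable_funM => //; apply/measurable_EFinP; exact: mind.
- by move=> w _; rewrite mule_ge0// lee_fin.
- by rewrite lee_fin -hv.
congr (_ * _)%E; rewrite [RHS]integral_mkcond; apply: eq_integral => w _.
by rewrite epatch_indic.
Qed.
End Approx.

(** The defining property of conditional expectations, passed from indicators to
    all nonnegative functions that are measurable for the smaller
    sigma-algebra. *)
Lemma cond_expectation_mul (X Y Z : Omega -> \bar R) :
  (forall w, (0 <= X w)%E) -> measurable_fun [set: Omega] X ->
  is_cond_expectation P C X Y ->
  (forall w, (0 <= Z w)%E) -> measurable_wrt C Z ->
  (\int[P]_w (Y w * Z w) = \int[P]_w (X w * Z w))%E.
Proof.
move=> X0 mX [Y0 mY XY] Z0 mZ.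
pose h := nnsfun_approx (measurableT : measurable [set: g_sigma_algebraType C]) mZ.
have nd_h w : {homo (fun n => h n w) : n m / (n <= m)%N >-> n <= m}.
  by move=> n m nm; exact/lefP/nd_nnsfun_approx.
have hZ w : (h n w)%:E @[n --> \oo] --> Z w.
  by apply: cvg_nnsfun_approx => // v _; exact: Z0.
rewrite (integral_mul_approx Y0 (measurable_wrt_fun mY) nd_h hZ).
rewrite (integral_mul_approx X0 mX nd_h hZ).
congr (limn _); apply/funext => n; apply: eq_fsbigr => y _; congr (_ * _)%E.
by apply: XY; exact: (measurable_sfunP (h n)).
Qed.

End CondExp.

(** An enumeration possibly with gaps, which treats finite and infinite types
    alike. *)
Lemma countable_enum (T : choiceType) : countable [set: T] ->
  exists (f : T -> nat) (g : nat -> option T), pcancel f g /\ ocancel g f.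
Proof.
move=> /countable_injP[f finj]; exists f.
exists (fun n => match pselect (exists e, f e = n) with
  | left p => Some (sval (cid p)) | right _ => None end); split.
  move=> e; case: pselect => [p|[]]; last by exists e.
  by case: cid => e' /= /finj -> //; exact: in_setT.
by move=> n; case: pselect => //= p; case: cid.
Qed.

Lemma esum_enum (R : realType) (T : choiceType) (f : T -> nat)
    (g : nat -> option T) (F : T -> \bar R) :
  pcancel f g -> ocancel g f -> (forall e, (0 <= F e)%E) ->
  (\esum_(e in [set: T]) F e = \sum_(n <oo) oapp F 0 (g n))%E.
Proof.
move=> fK gK F0; have G0 n : (0 <= oapp F 0 (g n))%E by case: (g n).
rewrite nneseries_esumT//.
transitivity (\esum_(n in f @` [set: T]) oapp F 0%E (g n)).
  rewrite esum_image; last by move=> e e' _ _; exact: (pcan_inj fK).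
  by apply: eq_esum => e _; rewrite fK.
rewrite esum_mkcond; apply: eq_esum => n _; case: ifPn => //.
rewrite notin_setE /= => nf; have := gK n; case: (g n) => //= e fe.
by exfalso; apply: nf; exists e.
Qed.

Section CondExpSum.
Context d (Omega : measurableType d) (R : realType).
Variables (P : probability Omega R) (C : set (set Omega)).
Hypothesis CM : C `<=` measurable.

Lemma cond_expectation_mul_on (X Y Z : Omega -> \bar R) A :
  (forall w, (0 <= X w)%E) -> measurable_fun [set: Omega] X ->
  is_cond_expectation P C X Y ->
  (forall w, (0 <= Z w)%E) -> measurable_wrt C Z -> <<s C>> A ->
  (\int[P]_(w in A) (Y w * Z w) = \int[P]_(w in A) (X w * Z w))%E.
Proof.
move=> X0 mX XY Z0 mZ CA.
rewrite [LHS]integral_mkcond [RHS]integral_mkcond.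
have ZA (V : Omega -> \bar R) w :
    ((fun w => (V w * Z w)%E) \_ A) w = (V w * (Z \_ A) w)%E.
  by rewrite /patch; case: ifP; rewrite ?mule0.
under eq_integral do rewrite ZA.
under [RHS]eq_integral do rewrite ZA.
apply: (cond_expectation_mul CM X0 mX XY).
  by move=> w; apply: erestrict_ge0.
apply: (measurable_restrictT (T1 := g_sigma_algebraType C) Z CA).1.
exact: measurable_funTS.
Qed.

(** The conditional series may have infinite integral, so the integrals are
    compared on the events [A k] where that series is at most [k]. *)
Lemma cond_expectation_series_finite (X Y Z : nat -> Omega -> \bar R) :
  (forall n w, (0 <= X n w)%E) ->
  (forall n, measurable_fun [set: Omega] (X n)) ->
  (forall n, is_cond_expectation P C (X n) (Y n)) ->
  (forall n w, (0 <= Z n w)%E) -> (forall n, measurable_wrt C (Z n)) ->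
  {ae P, forall w, (\sum_(n <oo) (Y n w * Z n w) < +oo)%E} ->
  {ae P, forall w, (\sum_(n <oo) (X n w * Z n w) < +oo)%E}.
Proof.
move=> X0 mX XY Z0 mZ finY.
have Y0 n w : (0 <= Y n w)%E by case: (XY n).
have mYZ n : measurable_wrt C (fun w => Y n w * Z n w)%E.
  have [_ mYn _] := XY n; exact: emeasurable_funM mYn (mZ n).
have mXZ n : measurable_fun [set: Omega] (fun w => X n w * Z n w)%E.
  apply: emeasurable_funM (mX n) _; exact: (measurable_wrt_fun CM (mZ n)).
have XZ0 n w : (0 <= X n w * Z n w)%E by rewrite mule_ge0 ?Y0 ?X0 ?Z0.
have YZ0 n w : (0 <= Y n w * Z n w)%E by rewrite mule_ge0 ?Y0 ?X0 ?Z0.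
pose SY w := (\sum_(n <oo) (Y n w * Z n w))%E.
pose SX w := (\sum_(n <oo) (X n w * Z n w))%E.
have mSY : measurable_wrt C SY.
  exact: (@ge0_emeasurable_sum _ (g_sigma_algebraType C) R setT
    (fun n w => Y n w * Z n w)%E xpredT (fun n w _ _ => YZ0 n w) (fun n _ => mYZ n)).
have mSX : measurable_fun [set: Omega] SX.
  exact: (@ge0_emeasurable_sum _ Omega R setT
    (fun n w => X n w * Z n w)%E xpredT (fun n w _ _ => XZ0 n w) (fun n _ => mXZ n)).
pose A k := [set w | (SY w <= k%:R%:E)%E].
have CA k : <<s C>> (A k).
  have -> : A k = SY @^-1` [set` Interval -oo%O (BRight k%:R%:E)].
    by apply/seteqP; split=> w /=; rewrite in_itv.
  rewrite -[_ @^-1` _]setTI.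
  exact: (mSY measurableT _ (@emeasurable_itv R _)).
have mA k : measurable (A k) by exact: (sigma_sub_measurable CM).
have finA k : {ae P, forall w, A k w -> SX w \is a fin_num}.
  apply: integrable_ae => //; apply/integrableP; split; first exact: measurable_funTS.
  under eq_integral => w _.
    rewrite gee0_abs; last by apply: nneseries_ge0.
    over.
  rewrite integral_nneseries//; last by move=> n; exact: measurable_funTS.
  (* exchange [X] for its conditional expectation, term by term *)
  under eq_eseriesr do rewrite -(cond_expectation_mul_on _ _ (XY _))//.
  rewrite -integral_nneseries//; last first.
    by move=> n; apply: measurable_funTS; exact: (measurable_wrt_fun CM).
  apply: (@le_lt_trans _ _ (\int[P]_(w in A k) (cst k%:R%:E w))%E).
    apply: ge0_le_integral => //.
    - by move=> w _; apply: nneseries_ge0.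
    - by apply: measurable_funTS; exact: (measurable_wrt_fun CM).
  rewrite integral_cst//; apply: lte_mul_pinfty => //.
  exact: le_lt_trans (probability_le1 _ _) (ltry _).
apply: filterS2 finY (ae_foralln finA) => w fY fA.
have SY0 : (0 <= SY w)%E by apply: nneseries_ge0.
have [k Ak] : exists k, A k w.
  exists (Num.truncn (fine (SY w))).+1; rewrite /A /= -(@fineK _ (SY w)).
    by rewrite lee_fin ltW// truncnS_gt.
  by rewrite ge0_fin_numE.
by have := fA k Ak; rewrite ge0_fin_numE//; apply: nneseries_ge0.
Qed.

Lemma cond_expectation_esum_finite (T : choiceType)
    (X Y Z : T -> Omega -> \bar R) : countable [set: T] ->
  (forall e w, (0 <= X e w)%E) ->
  (forall e, measurable_fun [set: Omega] (X e)) ->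
  (forall e, is_cond_expectation P C (X e) (Y e)) ->
  (forall e w, (0 <= Z e w)%E) -> (forall e, measurable_wrt C (Z e)) ->
  {ae P, forall w, (\esum_(e in [set: T]) (Y e w * Z e w) < +oo)%E} ->
  {ae P, forall w, (\esum_(e in [set: T]) (X e w * Z e w) < +oo)%E}.
Proof.
move=> /countable_enum[f [g [fK gK]]] X0 mX XY Z0 mZ finY.
have Y0 e w : (0 <= Y e w)%E by case: (XY e).
pose ext (V : T -> Omega -> \bar R) n : Omega -> \bar R :=
  if g n is Some e then V e else cst 0%E.
have extM V w : (forall e w, (0 <= V e w)%E) ->
    (\esum_(e in [set: T]) (V e w * Z e w) =
     \sum_(n <oo) (ext V n w * ext Z n w))%E.
  move=> V0; rewrite (esum_enum fK gK); last by move=> e; rewrite mule_ge0.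
  by apply: eq_eseriesr => n _; rewrite /ext; case: (g n) => //=; rewrite mule0.
apply: filterS (@cond_expectation_series_finite (ext X) (ext Y) (ext Z)
  _ _ _ _ _ _) => [w| | | | | |].
- by rewrite extM.
- by move=> n w; rewrite /ext; case: (g n) => /=.
- by move=> n; rewrite /ext; case: (g n) => [e|]; [exact: mX|exact: measurable_cst].
- move=> n; rewrite /ext; case: (g n) => [e|]; first exact: XY.
  split=> //; exact: measurable_cst.
- by move=> n w; rewrite /ext; case: (g n) => /=.
- by move=> n; rewrite /ext; case: (g n) => [e|]; [exact: mZ|exact: measurable_cst].
- by apply: filterS finY => w; rewrite extM.
Qed.
End CondExpSum.

(** * Repair of random demand networks *)

Theorem theorem4p5 (R : realType)
  (d : measure_display) (Omega : measurableType d) (P : probability Omega R)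
  (B : multigraph) (o : vertex B)
  (HBf : locally_finite B) (HBc : graph_connected B) (HBi : graph_infinite B)
  (H : multigraph) (HHf : locally_finite H) (HHi : graph_infinite H)
  (iota : vertex B -> vertex H) (Hiota : injective iota)
  (Phi : R -> R) (HPhi : is_gauge Phi)
  (p : R) (Hp : 0 <= p <= 1)
  (opened : edge H -> set Omega) (Hopened : bernoulli_percolation P p opened)
  (Gamma : edge B -> set (seq (dart H))) (HGamma : route_family iota Gamma)
  (D : Omega -> subgraph B) (HD : random_subgraph D)
  (gamma : Omega -> edge B -> seq (dart H)) (Hgamma : random_routes D gamma)
  (Husable : forall w,
     usable o Gamma [set a | opened a w] (D w) (gamma w))
  (Hloads : {ae P, forall w, admissible_loads (D w) (gamma w) Phi})
  (W : edge B -> Omega -> \bar R)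
  (HW : forall e w, W e w = route_cost (D w) (gamma w) Phi e)
  (EW : edge B -> Omega -> \bar R)
  (HEW : forall e, is_cond_expectation P (subgraph_events D) (W e) (EW e))
  (theta : Omega -> dart B -> R)
  (Hthetam : forall b, measurable_wrt (subgraph_events D) (fun w => theta w b))
  (Htheta : {ae P, forall w, unit_flow (D w) o (theta w)}) :
  ({ae P, forall w,
      (\esum_(e in edges (D w)) (EW e w * (Phi `|theta w (e, true)|)%:E)
        < +oo)%E} ->
   {ae P, forall w,
      (\esum_(e in edges (D w)) (W e w * (Phi `|theta w (e, true)|)%:E)
        < +oo)%E} /\
   {ae P, forall w,
      let S := [set a | opened a w] in
      let K := component S (iota o) in
      let Theta := lifted_flow (D w) (gamma w) (theta w) in
      [/\ unit_flow (spanning_subgraph S) (iota o) Theta,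
          (flow_energy Phi (full_graph H) Theta < +oo)%E
        & exists2 thetaK, unit_flow (D w) o thetaK &
            let ThetaK := lifted_flow (D w) (gamma w) thetaK in
            [/\ forall b, edges K b.1 -> ThetaK b = Theta b,
                unit_flow K (iota o) ThetaK
              & (flow_energy Phi K ThetaK < +oo)%E]]}) /\
  (forall C : edge B -> R,
   {ae P, forall w, forall e, edges (D w) e -> (EW e w <= (C e)%:E)%E} ->
   {ae P, forall w,
      (\esum_(e in edges (D w)) ((C e)%:E * (Phi `|theta w (e, true)|)%:E)
        < +oo)%E} ->
   {ae P, forall w,
      (\esum_(e in edges (D w)) (W e w * (Phi `|theta w (e, true)|)%:E)
        < +oo)%E}).
Proof.
have countB : countable [set: edge B] by exact: (countable_edges o).
pose Q e := [set r | Gamma e r].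
have countQ e : countable (Q e).
  apply: (sub_countable _ (countable_walks (iota (src e)) HHf)).
  apply: subset_card_le => r /HGamma /andP[wr _].
  by exists (iota (tgt e)).
have gammaQ w e : edges (D w) e -> Q e (gamma w e).
  by move=> De; have [_ _ /(_ e De)[]] := Husable w.
have gamma_path w e : edges (D w) e ->
    is_path (iota (src e)) (gamma w e) (iota (tgt e)).
  by move=> /gammaQ; exact: HGamma.
have gamma_open w e : edges (D w) e ->
    open_route [set a | opened a w] (gamma w e).
  by move=> De; have [_ _ /(_ e De)[]] := Husable w.
have W0 e w : (0 <= W e w)%E by rewrite HW route_cost_ge0.
have mW e : measurable_fun [set: Omega] (W e).
  rewrite (_ : W e = fun w => route_cost (D w) (gamma w) Phi e); last first.
    by apply/funext => w; exact: HW.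
  exact: (measurable_route_cost HD Hgamma countB countQ gammaQ).
pose phi e w := (Phi `|theta w (e, true)|)%:E.
have phi0 e w : (0 <= phi e w)%E by rewrite lee_fin gauge_ge0.
have mphi e : measurable_wrt (subgraph_events D) (phi e).
  have -> : phi e = EFin \o (fun x => Phi (Num.max 0 x)) \o
      (fun x => `|x|) \o (fun w => theta w (e, true)).
    by apply/funext => w /=; rewrite max_r.
  have mPhi : measurable_fun [set: R] (fun x : R => Phi (Num.max 0 x)).
    by apply: nondecreasing_measurable => //; exact: gauge_nondecreasing.
  apply: measurableT_comp (Hthetam (e, true)).
  apply: measurableT_comp (@normr_measurable R setT).
  exact: measurableT_comp (@EFin_measurable R setT) mPhi.
pose A e := [set w | edges (D w) e].
have CA e : <<s subgraph_events D>> (A e).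
  by apply: sub_gen_smallest; right; exists e.
pose Z e := phi e \_ (A e).
have esumZ (V : edge B -> Omega -> \bar R) w :
    (\esum_(e in edges (D w)) (V e w * phi e w) =
     \esum_(e in [set: edge B]) (V e w * Z e w))%E.
  rewrite esum_mkcond; apply: eq_esum => e _; rewrite /Z /patch.
  have -> : (w \in A e) = (e \in edges (D w)) by apply/idP/idP; rewrite !inE.
  by case: ifP; rewrite ?mule0.
have main : {ae P, forall w,
      (\esum_(e in edges (D w)) (EW e w * phi e w) < +oo)%E} ->
   {ae P, forall w,
      (\esum_(e in edges (D w)) (W e w * phi e w) < +oo)%E}.
  move=> finE.
  have := @cond_expectation_esum_finite _ _ _ P _ HD _ W EW Z countB W0 mW HEW.
  have Z0 e w : (0 <= Z e w)%E by apply: erestrict_ge0.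
  have mZ e : measurable_wrt (subgraph_events D) (Z e).
    apply: (measurable_restrictT (T1 := g_sigma_algebraType (subgraph_events D))
      _ (CA e)).1.
    by apply: measurable_funTS; exact: mphi.
  move=> /(_ Z0 mZ) imp.
  have /imp : {ae P, forall w,
      (\esum_(e in [set: edge B]) (EW e w * Z e w) < +oo)%E}.
    by apply: filterS finE => w; rewrite esumZ.
  by apply: filterS => w; rewrite esumZ.
split.
  move=> finE; have finW := main finE; split; first exact: finW.
  apply: filterS3 Hloads Htheta finW => w loads flow fW.
  apply: (lift_component HBf HHf Hiota (@gamma_path w) (@gamma_open w) flow HPhi).
    by move=> a; case: (loads a).
  by move: fW; under eq_esum do rewrite HW.
move=> C leC finC; apply: main.
apply: filterS2 leC finC => w leC; apply: le_lt_trans; apply: le_esum => e De.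
exact: lee_wpmul2r (leC e De).
Qed.
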